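(* Let $(R,m,K)$ be either a complete local domain, or a standard graded $K$-algebra domain, of positive characteristic $p$ and Krull dimension $n\ge2$. Then there exists an element of $E_{R^\infty}(K^\infty)$ that is not killed by any power of $m$.
   Context: All rings are commutative with identity. In the complete local case, $R$ is a complete Noetherian local domain with maximal ideal $m$ and residue field $K$. In the graded case, $K$ is a field and $R=\bigoplus_{i\ge0}R_i$ is an $\mathbb{N}$-graded domain with $R_0=K$, finitely generated over $K$ by elements of degree $1$, and $m=\bigoplus_{i>0}R_i$ is the homogeneous maximal ideal. For a reduced ring $A$ of characteristic $p$, $A^\infty$ denotes its perfect closure, obtained by adjoining all $q$-th roots of elements of $A$ for all powers $q=p^e$. $K^\infty$ is the residue field of $R^\infty$ (at its maximal ideal, resp. homogeneous maximal ideal, lying over $m$), hence an $R^\infty$-module. $E_{R^\infty}(K^\infty)$ is the injective hull of $K^\infty$ as an $R^\infty$-module (note that $R^\infty$ is in general not Noetherian). An element $v$ is not killed by any power of $m$ if $m^tv\ne0$ for every $t>0$. *)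

(* Defs.v *)
From HB Require Import structures.
From mathcomp Require Import all_boot all_algebra.
From mathcomp Require Import boolp classical_sets.

Set Implicit Arguments.
Unset Strict Implicit.
Unset Printing Implicit Defensive.

Import GRing.Theory.
Local Open Scope classical_set_scope.
Local Open Scope ring_scope.

(* Ideals, submodules and subrings are arbitrary (classical) sets; the closure
   predicates of the algebra library are applied to them through [in _]. *)

Definition submodule (R : nzRingType) (V : lmodType R) (N : set V) : Prop :=
  GRing.submod_closed [in N].

Definition ideal (R : comNzRingType) (I : set R) : Prop :=
  @submodule R R^o I.

(* idealr_closed includes properness. *)
Definition prime_ideal (R : comNzRingType) (P : set R) : Prop :=
  idealr_closed [in P] /\ prime_idealr_closed [in P].

Definition maximal_ideal (R : comNzRingType) (M : set R) : Prop :=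
  idealr_closed [in M] /\
  forall J : set R, idealr_closed [in J] -> M `<=` J -> J = M.

Definition ideal_gen (R : comNzRingType) (A : set R) : set R :=
  [set x | forall I : set R, ideal I -> A `<=` I -> I x].

Definition ideal_pow (R : comNzRingType) (I : set R) (t : nat) : set R :=
  ideal_gen [set x | exists2 f : 'I_t -> R,
                       forall k, I (f k) & x = \prod_k f k].

Definition noetherian (R : comNzRingType) : Prop :=
  forall I : set R, ideal I ->
    exists s : seq R, I = ideal_gen [set x | x \in s].

Definition local_ring (R : comNzRingType) (m : set R) : Prop :=
  maximal_ideal m /\ forall M : set R, maximal_ideal M -> M = m.

(* Completeness includes separatedness, i.e. R = lim R / I^t. *)
Definition adically_complete (R : comNzRingType) (I : set R) : Prop :=
  (forall x, (forall t, ideal_pow I t x) -> x = 0) /\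
  forall u : nat -> R,
    (forall t, exists N, forall k l, (N <= k)%N -> (N <= l)%N ->
       ideal_pow I t (u k - u l)) ->
    exists x, forall t, exists N, forall k, (N <= k)%N ->
       ideal_pow I t (u k - x).

Definition prime_chain (R : comNzRingType) (k : nat) (P : nat -> set R) : Prop :=
  (forall i, (i <= k)%N -> prime_ideal (P i)) /\
  (forall i, (i < k)%N -> P i `<` P i.+1).

Definition krull_dim (R : comNzRingType) (n : nat) : Prop :=
  (exists P, @prime_chain R n P) /\
  (forall k P, @prime_chain R k P -> (k <= n)%N).

Definition complete_local_domain (R : idomainType) (m : set R) : Prop :=
  [/\ noetherian R, local_ring m & adically_complete m].

Definition generates_ring (R : nzRingType) (A : set R) : Prop :=
  forall B : set R, GRing.subring_closed [in B] -> A `<=` B -> B = setT.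

Definition grading (R : comNzRingType) (G : nat -> set R) : Prop :=
  [/\ forall i, GRing.zmod_closed [in G i],
      forall i j x y, G i x -> G j y -> G (i + j)%N (x * y),
      forall x, exists N (a : nat -> R),
        (forall i, G i (a i)) /\ x = \sum_(i < N) a i
    & forall N (a : nat -> R), (forall i, G i (a i)) ->
        \sum_(i < N) a i = 0 -> forall i, (i < N)%N -> a i = 0].

Definition irrelevant_ideal (R : comNzRingType) (G : nat -> set R) : set R :=
  [set x | exists N (a : nat -> R),
     (forall i, G i (a i)) /\ x = \sum_(1 <= i < N) a i].

(* The structure map iota identifies K with the degree-zero part. *)
Definition standard_graded_over (K : fieldType) (R : idomainType)
    (iota : {rmorphism K -> R}) (G : nat -> set R) : Prop :=
  [/\ grading G, range iota = G 0%N
    & exists s : seq R, (forall x, x \in s -> G 1%N x) /\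
        generates_ring (range iota `|` [set x | x \in s])].

Definition standard_graded_domain (R : idomainType) (m : set R) : Prop :=
  exists (K : fieldType) (iota : {rmorphism K -> R}) (G : nat -> set R),
    standard_graded_over iota G /\ m = irrelevant_ideal G.

(* B is perfect and is obtained from A by adjoining p^e-th roots of its
   elements; this determines (B, i) up to unique isomorphism over A. *)
Definition is_perfect_closure (p : nat) (A B : comNzRingType)
    (i : {rmorphism A -> B}) : Prop :=
  [/\ injective i, bijective (fun x : B => x ^+ p)
    & generates_ring [set b : B | exists e a, b ^+ (p ^ e) = i a]].

Definition is_residue_field (A : comNzRingType) (n : set A) (L : fieldType)
    (pi : {rmorphism A -> L}) : Prop :=
  (forall y, exists x, pi x = y) /\ (forall x, pi x = 0 <-> n x).

(* L regarded as an A-module through pi. *)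
Definition residue_module (A : comNzRingType) (L : fieldType)
    (pi : {rmorphism A -> L}) : Type := L.

Section ResidueModule.
Variables (A : comNzRingType) (L : fieldType) (pi : {rmorphism A -> L}).

HB.instance Definition _ := GRing.Zmodule.copy (residue_module pi) L.

Let scale (a : A) (x : residue_module pi) : residue_module pi :=
  pi a * (x : L).

Let scaleA a b x : scale a (scale b x) = scale (a * b) x.
Proof. by rewrite /scale rmorphM mulrA. Qed.

Let scale1 : left_id 1 scale.
Proof. by move=> x; rewrite /scale rmorph1 mul1r. Qed.

Let scaleDr : right_distributive scale +%R.
Proof. by move=> a x y; apply: mulrDr. Qed.

Let scaleDl x : {morph scale^~ x : a b / a + b}.
Proof. by move=> a b; rewrite /scale rmorphD; apply: mulrDl. Qed.

HB.instance Definition _ :=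
  GRing.Zmodule_isLmodule.Build A (residue_module pi)
    scaleA scale1 scaleDr scaleDl.

End ResidueModule.

Definition injective_module (A : comNzRingType) (E : lmodType A) : Prop :=
  forall (M N : lmodType A) (f : {linear M -> N}) (g : {linear M -> E}),
    injective f -> exists h : {linear N -> E}, forall x, h (f x) = g x.

Definition essential (A : comNzRingType) (M E : lmodType A)
    (j : {linear M -> E}) : Prop :=
  forall N : set E, submodule N -> N <> [set 0] ->
    N `&` range j <> [set 0].

Definition is_injective_hull (A : comNzRingType) (M E : lmodType A)
    (j : {linear M -> E}) : Prop :=
  [/\ injective_module E, injective j & essential j].

(* Main.v *)
(* Write A for the perfect closure and y for an element of m. By injectivity of
   E, it suffices to find an ideal J and an element u of A such that
   (J : u) is contained in the maximal ideal and, up to a multiplier outside the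
   maximal ideal, u lies in J + (y^t) for every t: the map J + (u) -> E killing J
   and sending u to a socle element extends to A, and the image of 1 is killed by
   no y^t, since otherwise that socle element would vanish.

   To get J, choose x <> 0 and y in m such that no product of a power of y with
   an element outside m lies in (x), and let X_t be the p^t-th root of x. If for
   some t the element X_(t+1) lies, up to a multiplier, in (X_t : y^oo) + (y^d) for
   all d, take J = (X_t : y^oo) and u = X_(t+1). Otherwise there are bounds d_t for
   which this fails; put b_0 = 0 and b_(t+1) = b_t + d_t + 1, and let J be
   generated by the differences of the monomials X_(t+1) y^(b_t), with u = X_1.
   The failure at t says that the t-th monomial is not, even up to a multiplier,
   in (X_t, y^(b_(t+1))), an ideal containing all the others, so that every syzygy
   of the monomials has coefficients in the maximal ideal; a relation putting s u
   in J would be a syzygy with coefficient sum s.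

   In the local case x and y come from a chain of three primes. In the graded case
   they are sought among the generators; if none work, then R is finite over K[x]
   for some linear form x, so R has linear Hilbert growth, any two elements are
   algebraically dependent over K, and no chain of three primes exists. *)

Require Import Defs.
From HB Require Import structures.
From mathcomp Require Import all_boot all_algebra.
From mathcomp Require Import boolp classical_sets.
From mathcomp Require Import ring zify.
Import GRing.Theory.
Set Implicit Arguments.
Unset Strict Implicit.
Unset Printing Implicit Defensive.
Local Open Scope classical_set_scope.
Local Open Scope ring_scope.

(** * Ideals and extension of maps into injective modules *)

Lemma ideal_intro (A : comNzRingType) (I : set A) :
  I 0 -> (forall a x y, I x -> I y -> I (a * x + y)) -> ideal I.
Proof.
move=> I0 IL; split; first exact: mem_set.
by move=> a x y; rewrite !inE; apply: IL.
Qed.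

Lemma ideal0 (A : comNzRingType) (I : set A) : ideal I -> I 0.
Proof. by case; rewrite inE. Qed.

Lemma idealMD (A : comNzRingType) (I : set A) : ideal I ->
  forall a x y, I x -> I y -> I (a * x + y).
Proof.
by move=> [_ IL] a x y Ix Iy; apply: set_mem; apply: IL; exact: mem_set.
Qed.

Lemma idealB (A : comNzRingType) (I : set A) : ideal I ->
  forall x y, I x -> I y -> I (x - y).
Proof. by move=> hI x y Ix Iy; rewrite addrC -mulN1r; apply: idealMD. Qed.

Section IdealModule.
Variables (A : comNzRingType) (I : set A) (hI : ideal I).

(* The phantom proof argument is what lets inference find the closure instance. *)
Definition ideal_mem (_ : ideal I) : {pred A^o} := [in I].

HB.instance Definition _ :=
  GRing.isSubmodClosed.Build A A^o (ideal_mem hI) (GRing.submod_closed_semi hI).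

Record ideal_module := IdealModule
  { ideal_val : A^o; ideal_valP : ideal_val \in ideal_mem hI }.

HB.instance Definition _ := [isSub for ideal_val].
HB.instance Definition _ := [Choice of ideal_module by <:].
HB.instance Definition _ := [SubChoice_isSubLmodule of ideal_module by <:].

End IdealModule.

(** Since (J : u) kills [e], sending z = a + s u with a in J to s e is well defined on the ideal J +
    (u); injectivity extends this map to [A]. *)
Lemma injective_module_cyclic (A : comNzRingType) (E : lmodType A)
    (J : set A) (u : A) (e : E) :
  injective_module E -> ideal J -> (forall s, J (s * u) -> s *: e = 0) ->
  exists2 h : {linear A^o -> E}, h u = e & forall a, J a -> h a = 0.
Proof.
move=> injE hJ eP.
pose I : set A := [set z | exists s, J (z - s * u)].
have hI : ideal I.
  apply: ideal_intro => [|a x y [s Js] [t Jt]].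
    by exists 0; rewrite mul0r subr0; apply: ideal0.
  exists (a * s + t); have -> : a * x + y - (a * s + t) * u =
    a * (x - s * u) + (y - t * u) by ring.
  exact: idealMD.
have Ival (z : ideal_module hI) : I (\val z) by apply: set_mem; apply: valP.
(* An arbitrary choice of coefficient of [u]; by [cE] the product with [e] does not depend on it,
   which yields linearity. *)
pose c z := projT1 (cid (Ival z)).
have cP z : J (\val z - c z * u) by rewrite /c; case: cid.
have cE z s : J (\val z - s * u) -> c z *: e = s *: e.
  move=> Jz; apply/eqP; rewrite -subr_eq0 -scalerBl; apply/eqP/eP.
  have -> : (c z - s) * u = (\val z - s * u) - (\val z - c z * u) by ring.
  exact: idealB.
pose g z := c z *: e.
have g_lin : linear g.
  move=> a x y; rewrite /g (cE _ (a * c x + c y)).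
    by rewrite scalerDl scalerA.
  have -> : \val (a *: x + y) - (a * c x + c y) * u =
    a * (\val x - c x * u) + (\val y - c y * u).
    by rewrite linearP /= /GRing.scale /=; ring.
  exact: idealMD.
pose gL : {linear ideal_module hI -> E} :=
  HB.pack g (GRing.isLinear.Build _ _ _ _ g g_lin).
have [h hE] := injE _ _ (\val : {linear ideal_module hI -> A^o}) gL val_inj.
have inI z : I z -> z \in ideal_mem hI by apply: mem_set.
exists h => [|a Ja].
  have Iu : I u by exists 1; rewrite mul1r subrr; apply: ideal0.
  have /= -> := hE (IdealModule (inI _ Iu)).
  by rewrite /g (cE _ 1) ?scale1r //= mul1r subrr; apply: ideal0.
have Ia : I a by exists 0; rewrite mul0r subr0.
have /= -> := hE (IdealModule (inI _ Ia)).
by rewrite /g (cE _ 0) ?scale0r //= mul0r subr0.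
Qed.

Lemma injective_module_not_torsion (A : comNzRingType) (L : fieldType)
    (pi : {rmorphism A -> L}) (E : lmodType A)
    (j : {linear residue_module pi -> E}) (J : set A) (u y : A) :
  injective_module E -> injective j -> ideal J ->
  (forall s, J (s * u) -> pi s = 0) ->
  (forall t, exists s c, pi s != 0 /\ J (s * u - c * y ^+ t)) ->
  exists v : E, forall t, y ^+ t *: v <> 0.
Proof.
move=> injE injj hJ uP uJ.
pose one : residue_module pi := (1 : L).
have scE s : s *: j one = j (pi s : L).
  by rewrite -linearZ_LR; congr (j _); rewrite /GRing.scale /= mulr1.
have eP s : J (s * u) -> s *: j one = 0.
  by move=> /uP; rewrite scE => ->; rewrite linear0.
have [h hu hJ0] := injective_module_cyclic injE hJ eP.
have hM a b : h (a * b) = a *: h b by rewrite -linearZ_LR.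
exists (h 1) => t; rewrite -hM mulr1 => hy.
have [s [c [s0 /hJ0]]] := uJ t.
rewrite linearB /= !hM hy scaler0 subr0 hu scE => js0.
by move/eqP: s0; apply; apply: injj; rewrite js0 linear0.
Qed.

(** * Ideals that are not closed in the y-adic topology *)

Section NonSeparatedIdeal.
Variables (A : comNzRingType) (L : fieldType) (pi : {rmorphism A -> L}).
Variables (X : nat -> A) (y : A).
Hypothesis X_dvd : forall t, exists w, X t = w * X t.+1.
Hypothesis X_colon :
  forall t s k r, s * X t.+1 * y ^+ k = r * X t -> pi s = 0.

Lemma colon_chain_dvd l k : (l <= k)%N -> exists w, X l = w * X k.
Proof.
elim: k => [|k IH]; first by rewrite leqn0 => /eqP->; exists 1; rewrite mul1r.
rewrite leq_eqVlt => /predU1P[->|]; first by exists 1; rewrite mul1r.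
by move=> /IH[w ->]; have [v ->] := X_dvd k; exists (w * v); rewrite mulrA.
Qed.

Lemma colon_ideal a : ideal [set z | exists k r, z * y ^+ k = r * a].
Proof.
apply: ideal_intro => [|b z1 z2 [k1 [r1 e1]] [k2 [r2 e2]]].
  by exists 0%N, 0; rewrite !mul0r.
exists (k1 + k2)%N, (b * r1 * y ^+ k2 + r2 * y ^+ k1).
rewrite exprD mulrDl; have -> : b * z1 * (y ^+ k1 * y ^+ k2) =
  b * (z1 * y ^+ k1) * y ^+ k2 by ring.
have -> : z2 * (y ^+ k1 * y ^+ k2) = z2 * y ^+ k2 * y ^+ k1 by ring.
by rewrite e1 e2; ring.
Qed.

Section Staircase.
Variable D : nat -> nat.
Hypothesis DP : forall t s c k r,
  (s * X t.+1 - c * y ^+ D t) * y ^+ k = r * X t -> pi s = 0.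

(** The successor makes the exponents strictly increasing whatever [D] is, so that the monomial of
    index t is divisible by [y ^+ t]. *)
Fixpoint stair_exp t := if t is t'.+1 then (stair_exp t' + D t').+1 else 0%N.

Definition stair t := X t.+1 * y ^+ stair_exp t.

Lemma stair_exp_homo : {homo stair_exp : s t / (s <= t)%N}.
Proof.
apply: homo_leq => [t|t s u|t]; [exact: leqnn|exact: leq_trans|].
by rewrite /= -addnS leq_addr.
Qed.

Lemma leq_stair_exp t : (t <= stair_exp t)%N.
Proof. by elim: t => //= t IH; rewrite ltnS (leq_trans IH) ?leq_addr. Qed.

(** Earlier monomials are multiples of [X t], later ones of [y ^+ stair_exp t.+1]. Hence
    [d t * stair t] lies in the ideal of these two elements, which is the situation of [DP] with [k]
    equal to [stair_exp t]. *)
Lemma stair_syzygy M (d : nat -> A) t : (t < M)%N ->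
  \sum_(i < M) d i * stair i = 0 -> pi (d t) = 0.
Proof.
move=> tM; rewrite (bigD1 (Ordinal tM)) //=.
have [r [c ->]] : exists r c, \sum_(i < M | i != Ordinal tM) d i * stair i =
    r * X t + c * y ^+ stair_exp t.+1.
  apply: (big_ind (fun z => exists r c, z = r * X t + c * y ^+ stair_exp t.+1)).
  - by exists 0, 0; rewrite !mul0r addr0.
  - move=> _ _ [r1 [c1 ->]] [r2 [c2 ->]].
    by exists (r1 + r2), (c1 + c2); ring.
  move=> i; rewrite -val_eqE /= neq_ltn => /orP[it|ti].
    have [w wE] := colon_chain_dvd it.
    by exists (d i * w * y ^+ stair_exp i), 0; rewrite /stair wE; ring.
  exists 0, (d i * X i.+1 * y ^+ (stair_exp i - stair_exp t.+1)).
  rewrite /stair mul0r add0r -[in LHS](subnK (stair_exp_homo ti)) exprD; ring.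
rewrite /stair /= => /eqP; rewrite addr_eq0 => /eqP dE.
apply: (@DP t _ (- c * y) (stair_exp t) (- r)).
rewrite mulrBl -mulrA dE -addnS exprD exprS; ring.
Qed.

(** The ideal generated by the differences of the monomials: combinations with coefficient sum 0.
    Asking for all [M] beyond [N] forces [c] to vanish from [N] on and lets two combinations be
    added without aligning their lengths. *)
Definition stair_ideal : set A := [set z | exists (c : nat -> A) N,
  forall M, (N <= M)%N ->
    \sum_(i < M) c i = 0 /\ \sum_(i < M) c i * stair i = z].

Lemma stair_ideal_ideal : ideal stair_ideal.
Proof.
apply: ideal_intro => [|a z1 z2 [c1 [N1 h1]] [c2 [N2 h2]]].
  exists (fun=> 0), 0%N => M _; rewrite big1 // big1 // => i _.
  by rewrite mul0r.
exists (fun i => a * c1 i + c2 i), (maxn N1 N2) => M.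
rewrite geq_max => /andP[/h1[s1 <-] /h2[s2 <-]]; split.
  by rewrite big_split /= -mulr_sumr s1 s2 mulr0 addr0.
rewrite mulr_sumr -big_split; apply: eq_bigr => i _ /=; ring.
Qed.

Lemma sum_indicator M (F : nat -> A) t : (t < M)%N ->
  \sum_(i < M) (i == t :> nat)%:R * F i = F t.
Proof.
move=> tM; rewrite (bigD1 (Ordinal tM)) //= eqxx mul1r big1 ?addr0 // => i.
by rewrite -val_eqE /= => /negPf->; rewrite mul0r.
Qed.

Lemma stair_ideal_sub t : stair_ideal (stair 0 - stair t).
Proof.
exists (fun i => (i == 0%N)%:R - (i == t)%:R), t.+1 => M tM.
have M0 : (0 < M)%N by apply: leq_ltn_trans tM.
split; last first.
  under eq_bigr do rewrite mulrBl.
  by rewrite sumrB !sum_indicator.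
have ind1 k : (k < M)%N -> \sum_(i < M) (i == k :> nat)%:R = 1 :> A.
  move=> kM; rewrite -[RHS](sum_indicator (fun=> 1) kM).
  by apply: eq_bigr => i _; rewrite mulr1.
by rewrite sumrB !ind1 // subrr.
Qed.

Lemma stair_ideal_colon s : stair_ideal (s * stair 0) -> pi s = 0.
Proof.
move=> [c [N /(_ N.+1 (leqnSn _))[c0 cs]]].
(* Moving [s * stair 0] to the other side gives a syzygy of coefficient sum [- s], all of whose
   coefficients are killed by [pi]. *)
pose d i := c i - (i == 0%N)%:R * s.
have sd : \sum_(i < N.+1) d i = - s.
  by rewrite sumrB c0 (sum_indicator (fun=> s)) // sub0r.
have ds : \sum_(i < N.+1) d i * stair i = 0.
  under eq_bigr do rewrite mulrBl -mulrA.
  by rewrite sumrB cs (sum_indicator (fun i => s * stair i)) // subrr.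
apply/eqP; rewrite -oppr_eq0 -rmorphN -sd rmorph_sum big1 // => i _.
exact: stair_syzygy ds.
Qed.

End Staircase.

Lemma exists_nonseparated_ideal : exists (J : set A) (u : A),
  [/\ ideal J, forall s, J (s * u) -> pi s = 0
    & forall t, exists s c, pi s != 0 /\ J (s * u - c * y ^+ t)].
Proof.
have [[t tP]|noD] := pselect (exists t, forall D, exists s c k r,
    pi s != 0 /\ (s * X t.+1 - c * y ^+ D) * y ^+ k = r * X t).
  exists [set z | exists k r, z * y ^+ k = r * X t], (X t.+1).
  split=> [|s [k [r e]]|D]; first exact: colon_ideal.
    exact: X_colon e.
  have [s [c [k [r [s0 e]]]]] := tP D.
  by exists s, c; split=> //; exists k, r.
have Dex t : exists D, forall s c k r,
    (s * X t.+1 - c * y ^+ D) * y ^+ k = r * X t -> pi s = 0.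
  apply: contrapT => tP; apply: noD; exists t => D; apply: contrapT => DP.
  apply: tP; exists D => s c k r e; apply/eqP/negPn/negP => s0.
  by apply: DP; exists s, c, k, r.
have [D DP] := choice Dex.
exists (stair_ideal D), (stair D 0); split=> [|s|t].
- exact: stair_ideal_ideal.
- exact: stair_ideal_colon.
(* The multiplier is 1: [c * y ^+ t] is the monomial of index t, and its difference with the first
   monomial is in the ideal. *)
exists 1, (X t.+1 * y ^+ (stair_exp D t - t)); rewrite rmorph1 oner_eq0 mul1r.
split=> //; rewrite -mulrA -exprD subnK ?leq_stair_exp //.
exact: stair_ideal_sub.
Qed.

End NonSeparatedIdeal.

(** * Perfect closures *)

Section PerfectClosure.
Variables (R : idomainType) (p : nat) (pR : p \in [pchar R]).
Variables (Rinf : comNzRingType) (i : {rmorphism R -> Rinf}).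
Hypothesis Hi : is_perfect_closure p i.

Let p_gt0 : (0 < p)%N. Proof. by rewrite prime_gt0 ?(pcharf_prime pR). Qed.

(** By additivity of Frobenius, the elements having some p^e-th power in the image of [R] form a
    subring, and it contains the generators. All larger exponents work too, so finitely many
    elements share one. *)
Lemma perfect_closure_root_leq b :
  exists e, forall k, (e <= k)%N -> exists a, b ^+ (p ^ k) = i a.
Proof.
suff [e [a ba]] : exists e a, b ^+ (p ^ e) = i a.
  exists e => k ek; exists (a ^+ (p ^ (k - e))).
  by rewrite rmorphXn /= -ba -exprM -expnD subnKC.
have [_ _ gen] := Hi.
pose B := [set c | exists e a, c ^+ (p ^ e) = i a].
suff BT : B = setT by have : B b by rewrite BT.
apply: gen => //; split; first by rewrite inE; exists 0%N, 1; rewrite rmorph1 expr1n.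
  move=> b1 b2; rewrite !inE => -[e1 [a1 E1]] [e2 [a2 E2]].
  exists (e1 + e2)%N, (a1 ^+ (p ^ e2) - a2 ^+ (p ^ e1)).
  have pRinf : [pchar Rinf].-nat (p ^ (e1 + e2))%N.
    by rewrite pnatX pnatE ?(pcharf_prime pR) // (rmorph_pchar i pR).
  rewrite exprDn_pchar // exprNn_pchar // rmorphB !rmorphXn /= -E1 -E2 -!exprM -!expnD.
  by rewrite [(e2 + e1)%N]addnC.
move=> b1 b2; rewrite !inE => -[e1 [a1 E1]] [e2 [a2 E2]].
exists (e1 + e2)%N, (a1 ^+ (p ^ e2) * a2 ^+ (p ^ e1)).
rewrite exprMn rmorphM !rmorphXn /= -E1 -E2 -!exprM -!expnD.
by rewrite [(e2 + e1)%N]addnC.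
Qed.

Lemma perfect_closure_frobenius_inj k : injective (fun b : Rinf => b ^+ (p ^ k)).
Proof.
have [_ /bij_inj pinj _] := Hi.
elim: k => [|k IH] b c; first by rewrite !expr1.
by rewrite expnSr !exprM => /pinj /IH.
Qed.

(** A common p^k-th power carries the equation into the domain [R], and Frobenius is injective on
    [Rinf]. *)
Lemma perfect_closure_mulf_eq0 (b c : Rinf) : b * c = 0 -> b = 0 \/ c = 0.
Proof.
move=> bc0; have [iinj _ _] := Hi.
have [e1 h1] := perfect_closure_root_leq b.
have [e2 h2] := perfect_closure_root_leq c.
set k := maxn e1 e2.
have [a1 E1] := h1 k (leq_maxl _ _); have [a2 E2] := h2 k (leq_maxr _ _).
have q0 : 0 = (0 : Rinf) ^+ (p ^ k) by rewrite expr0n eqn0Ngt expn_gt0 p_gt0.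
have /eqP : a1 * a2 = 0.
  by apply: iinj; rewrite rmorphM /= -E1 -E2 -exprMn bc0 rmorph0 -q0.
rewrite mulf_eq0 => /orP[]/eqP a0; [left|right];
  apply: (@perfect_closure_frobenius_inj k); rewrite /= -q0.
  by rewrite E1 a0 rmorph0.
by rewrite E2 a0 rmorph0.
Qed.

Variables (L : fieldType) (pi : {rmorphism Rinf -> L}).
Variables (x y : R).
Hypothesis x_neq0 : x != 0.
Hypothesis xy_colon : forall s k r, s * y ^+ k = r * x -> pi (i s) = 0.

(** The roots of [x] satisfy the colon condition of [exists_nonseparated_ideal]: a high Frobenius
    power turns a relation between them into one in [R], where [xy_colon] applies. *)
Lemma perfect_closure_nonseparated_ideal :
  exists (J : set Rinf) (u : Rinf),
  [/\ ideal J, forall s, J (s * u) -> pi s = 0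
    & forall t, exists s c, pi s != 0 /\ J (s * u - c * i y ^+ t)].
Proof.
have [iinj [frob_inv _ frobK] _] := Hi.
pose X t := iter t frob_inv (i x).
have XS t : X t = X t.+1 ^+ p by rewrite /X /= frobK.
have X0 t : X t ^+ (p ^ t) = i x.
  by elim: t => [|t IH]; rewrite ?expr1 // expnS exprM -XS.
have XP t : X t = X t.+1 ^+ p.-1 * X t.+1 by rewrite -exprSr prednK.
apply: (@exists_nonseparated_ideal _ _ pi X) => t.
  by exists (X t.+1 ^+ p.-1).
move=> s k r e.
(* Cancel [X t.+1], which is nonzero because one of its powers is [i x]. *)
have {}e : s * i y ^+ k = r * X t.+1 ^+ p.-1.
  have /perfect_closure_mulf_eq0[/eqP|Xt0] :
      (s * i y ^+ k - r * X t.+1 ^+ p.-1) * X t.+1 = 0.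
  - by rewrite mulrBl -[r * _ * _]mulrA -XP -e; ring.
  - by rewrite subr_eq0 => /eqP.
  case/eqP: x_neq0; apply: iinj.
  by rewrite -(X0 t.+1) Xt0 rmorph0 expr0n expn_eq0 eqn0Ngt p_gt0.
have [e1 h1] := perfect_closure_root_leq s.
have [e2 h2] := perfect_closure_root_leq r.
pose q := maxn t.+1 (maxn e1 e2).
have [|s' Es] := h1 q; first by rewrite !leq_max leqnn !orbT.
have [|r' Er] := h2 q; first by rewrite !leq_max leqnn !orbT.
have tq : (t.+1 <= q)%N by rewrite leq_maxl.
(* The exponent of [x] after raising to the power p^q; it is positive as p > 1, so one factor [x]
   can be split off. *)
have pos : (0 < p.-1 * p ^ (q - t.+1))%N.
  by rewrite muln_gt0 expn_gt0 p_gt0 -subn1 subn_gt0 prime_gt1 ?(pcharf_prime pR).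
have : pi (i s') = 0.
  apply: (@xy_colon _ (k * p ^ q) (r' * x ^+ (p.-1 * p ^ (q - t.+1)).-1)).
  apply: iinj; rewrite -mulrA -exprSr prednK // !rmorphM !rmorphXn /= -Es -Er.
  rewrite exprM -exprMn e exprMn; congr (_ * _).
  by rewrite -(X0 t.+1) -!exprM mulnCA -expnD subnKC.
rewrite -Es rmorphXn /= => /eqP; rewrite expf_eq0 => /andP[_ /eqP->] //.
Qed.

End PerfectClosure.

(** * Chains of primes and the local case *)

Lemma proper_ideal_sub_maximal (R : comNzRingType) (I : set R) :
  idealr_closed [in I] -> exists2 M : set R, maximal_ideal M & I `<=` M.
Proof.
move=> hI.
pose Q (J : set R) := J = set0 \/ idealr_closed [in J] /\ I `<=` J.
have [|M [QM Mmax]] := @Zorn_bigcup R Q.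
  move=> F FQ Ftot; have [[J0 FJ0 J00]|noF] :=
      pselect (exists2 J, F J & J <> set0); last first.
    left; rewrite -subset0 => z [J FJ Jz]; apply: noF; exists J => // J0.
    by rewrite J0 in Jz.
  right; have [//|[hJ0 IJ0]] := FQ _ FJ0.
  split; last by move=> z /IJ0 ?; exists J0.
  split.
  - by apply: mem_set; exists J0 => //; apply: set_mem; case: hJ0.
  - rewrite notin_setE => -[J FJ J1]; have [J0'|[[_ /negP + _] _]] := FQ _ FJ.
      by rewrite J0' in J1.
    by apply; apply: mem_set.
  - move=> a u v /set_mem[J1 FJ1 J1u] /set_mem[J2 FJ2 J2v]; apply: mem_set.
    have [J FJ [Ju Jv]] : exists2 J, F J & J u /\ J v.
      case: (Ftot _ _ FJ1 FJ2) => h; [exists J2 | exists J1] => //.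
        by split=> //; apply: h.
      by split=> //; apply: h.
    exists J => //; apply: set_mem.
    have [J0'|[[_ _ h] _]] := FQ _ FJ; first by rewrite J0' in Ju.
    by apply: h; apply: mem_set.
have I0 : I 0 by apply: set_mem; case: hI.
case: QM => [M0|[hM IM]].
  exfalso; apply: (Mmax I); last by right; split.
  by rewrite M0; split=> // /(_ 0 I0).
exists M => //; split=> // J hJ MJ; apply: contrapT => JM.
apply: (Mmax J); last by right; split=> // z /IM /MJ.
by split=> // JsM; apply: JM; apply/seteqP.
Qed.

Lemma prime_chain_witness (R : comNzRingType) n (P : nat -> set R) :
  prime_chain n P -> (2 <= n)%N -> exists x y : R,
  [/\ x != 0, P 1%N x, P 2%N y & ~ P 1%N y].
Proof.
move=> [pP sP] n2.
have [_ /existsNP[x /not_implyP[P1x P0x]]] := sP 0%N (ltnW n2).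
have [_ /existsNP[y /not_implyP[P2y P1y]]] := sP 1%N n2.
exists x, y; split=> //; apply: contra_notN P0x => /eqP->.
by have [[+ _ _] _] := pP 0%N isT; rewrite inE.
Qed.

Section PrimeIdeal.
Variables (R : comNzRingType) (P : set R).
Hypothesis pP : prime_ideal P.

Lemma prime_idealM a x : P x -> P (a * x).
Proof.
move=> Px; have [[P0 _ h] _] := pP; apply: set_mem.
by rewrite -[a * x]addr0; apply: h => //; apply: mem_set.
Qed.

Lemma prime_idealB x y : P x -> P y -> P (x - y).
Proof.
move=> Px Py; have [[_ _ h] _] := pP; apply: set_mem.
by rewrite addrC -mulN1r; apply: h; apply: mem_set.
Qed.

Lemma prime_ideal1 : ~ P 1.
Proof. by have [[_ /negP h _] _] := pP; move=> ?; apply: h; apply: mem_set. Qed.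

Lemma prime_ideal_mul x y : P (x * y) -> P x \/ P y.
Proof. by have [_ h] := pP; move=> /mem_set/h/orP[]/set_mem; [left|right]. Qed.

Lemma prime_idealX x k : P (x ^+ k) -> P x.
Proof.
by elim: k => [/prime_ideal1|k IH]; rewrite // exprS => /prime_ideal_mul[|/IH].
Qed.

End PrimeIdeal.

(** Take x in the middle prime of the chain and y outside it: the equation puts [s * y ^+ k] in that
    prime, hence also [s], and every proper ideal lies in [m]. *)
Lemma local_ring_colon_witness (R : idomainType) (m : set R) n :
  local_ring m -> krull_dim R n -> (2 <= n)%N ->
  exists x y : R, [/\ x != 0, m y & forall s k r, s * y ^+ k = r * x -> m s].
Proof.
move=> [_ mu] [[P hP] _] n2.
have [x [y [x0 P1x P2y P1y]]] := prime_chain_witness hP n2.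
have [pP sP] := hP.
have Pm k : (k <= n)%N -> P k `<=` m.
  by move=> /pP[/proper_ideal_sub_maximal[M hM PM] _]; rewrite -(mu _ hM).
exists x, y; split=> //; first exact: (Pm 2%N).
move=> s k r e; have pP1 := pP 1%N (ltnW n2).
apply: (Pm 1%N (ltnW n2)); have : P 1%N (s * y ^+ k).
  by rewrite e; apply: prime_idealM.
by case/(prime_ideal_mul pP1) => // /(prime_idealX pP1).
Qed.

(** * Standard graded domains *)

Section StandardGraded.
Variables (K : fieldType) (R : idomainType) (kR : {rmorphism K -> R}).
Variable G : nat -> set R.
Hypothesis gradG : grading G.
Hypothesis G0 : range kR = G 0%N.

(* A decomposition into homogeneous components is encoded as a polynomial in an
   auxiliary variable, so that multiplication of decompositions is that of
   polynomials and evaluation at 1 recovers the element. *)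
Definition homog (P : {poly R}) := forall i, G i P`_i.

Let GB i x y : G i x -> G i y -> G i (x - y).
Proof.
have [gz _ _ _] := gradG; have [_ h] := gz i => Gx Gy.
by apply: set_mem; apply: h; apply: mem_set.
Qed.

Let Gz i : G i 0.
Proof. by have [gz _ _ _] := gradG; have [h _] := gz i; apply: set_mem. Qed.

Let GD i x y : G i x -> G i y -> G i (x + y).
Proof.
by move=> Gx Gy; rewrite -[y]opprK; apply: GB => //; rewrite -sub0r; apply: GB.
Qed.

Let GM i j x y : G i x -> G j y -> G (i + j)%N (x * y).
Proof. by have [_ gm _ _] := gradG; apply: gm. Qed.

Let Giota c : G 0%N (kR c). Proof. by rewrite -G0; exists c. Qed.

Let Gsum i (I : finType) (P : pred I) (F : I -> R) :
  (forall k, P k -> G i (F k)) -> G i (\sum_(k | P k) F k).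
Proof. by move=> h; apply: big_ind => //; apply: GD. Qed.

Lemma homogB P Q : homog P -> homog Q -> homog (P - Q).
Proof. by move=> hP hQ i; rewrite coefB; apply: GB. Qed.

Lemma homogM P Q : homog P -> homog Q -> homog (P * Q).
Proof.
move=> hP hQ i; rewrite coefM; apply: Gsum => j _.
by have := GM (hP j) (hQ (i - j)%N); rewrite subnKC // -ltnS.
Qed.

Lemma homog_monom d z : G d z -> homog (z *: 'X^d).
Proof.
by move=> Gz' i; rewrite coefZ coefXn; case: eqP => [->|_]; rewrite ?mulr1 ?mulr0.
Qed.

Lemma homogXn P k : homog P -> homog (P ^+ k).
Proof.
move=> hP; elim: k => [|k IH]; last by rewrite exprS; apply: homogM.
have := @homog_monom 0%N 1; rewrite expr0 scale1r; apply.
by rewrite -(rmorph1 kR).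
Qed.

Lemma homog_exists z : exists2 P, homog P & P.[1] = z.
Proof.
have [_ _ /(_ z)[N [a [Ga ->]]] _] := gradG.
exists (\poly_(i < N) a i) => [i|]; first by rewrite coef_poly; case: ifP.
by rewrite horner_poly; apply: eq_bigr => i _; rewrite expr1n mulr1.
Qed.

(** Uniqueness of homogeneous decompositions; it reduces an equation in [R] to equations between
    components. *)
Lemma homog_eval_inj P Q : homog P -> homog Q -> P.[1] = Q.[1] -> P = Q.
Proof.
move=> hP hQ e; apply/eqP; rewrite -subr_eq0; apply/eqP/polyP => i.
rewrite coef0; have [_ _ _ gu] := gradG.
have [iP|/leq_sizeP->//] := ltnP i (size (P - Q)).
apply: gu iP; first exact: homogB.
have := horner_coef (P - Q) 1; rewrite hornerD hornerN e subrr => {}e.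
by rewrite [RHS]e; apply: eq_bigr => k _; rewrite expr1n mulr1.
Qed.

Lemma homog_irrelevant P : homog P -> P`_0 = 0 -> irrelevant_ideal G P.[1].
Proof.
move=> hP P0; exists (size P), (fun i => P`_i); split=> //.
rewrite horner_coef; under eq_bigr do rewrite expr1n mulr1.
rewrite -(big_mkord xpredT (fun i => P`_i)).
case: (size P) => [|N]; first by rewrite !big_geq.
by rewrite big_ltn // P0 add0r.
Qed.

Lemma homog_dvd x w k r : G 1%N x -> G k.+1 w -> w = r * x ->
  exists2 r', G k r' & w = r' * x.
Proof.
move=> Gx Gw e; have [P hP Pr] := homog_exists r.
have /(congr1 (fun Q : {poly R} => Q`_k.+1)) : w *: 'X^(k.+1) = P * (x *: 'X^1).
  apply: homog_eval_inj; [exact: homog_monom|apply: homogM => //; exact: homog_monom|].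
  by rewrite hornerM !hornerZ !hornerXn !expr1n !mulr1 Pr.
rewrite coefZ coefXn eqxx mulr1 -scalerAr coefZ coefMXn /= subn1 /= mulrC.
by exists P`_k.
Qed.

(** If [s] had a nonzero degree-zero component, a unit from [K], then the degree-k component of the
    equation would make [y ^+ k] a multiple of [x]. *)
Lemma irrelevant_ideal_colon x y : G 1%N x -> G 1%N y ->
  (forall k r, y ^+ k <> r * x) ->
  forall s k r, s * y ^+ k = r * x -> irrelevant_ideal G s.
Proof.
move=> Gx Gy yx s k r e.
have [P hP Ps] := homog_exists s; have [Q hQ Qr] := homog_exists r.
have E : P * (y *: 'X^1) ^+ k = Q * (x *: 'X^1).
  apply: homog_eval_inj.
  - by apply: homogM => //; apply: homogXn; apply: homog_monom.
  - by apply: homogM => //; apply: homog_monom.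
  by rewrite !(hornerM, hornerZ, horner_exp, hornerX) !expr1n !mulr1 Ps Qr.
rewrite -Ps; apply: homog_irrelevant => //; apply/eqP/negPn/negP => P0.
have : G 0%N P`_0 by []; rewrite -G0 => -[c _ cP].
have c0 : c != 0 by apply: contraNneq P0 => c0; rewrite -cP c0 rmorph0.
have /(congr1 (fun Q : {poly R} => Q`_k)) := E.
rewrite expr1 exprZn -!scalerAr !coefZ coefMXn ltnn subnn -cP coefMX => e'.
(* For [k] equal to 0 the right-hand side has no component of degree [k], whence the value 0. *)
apply: (yx k (kR c^-1 * (if k == 0%N then 0 else Q`_k.-1))).
rewrite -mulrA [_ * x]mulrC -e' mulrCA -rmorphM mulVf // rmorph1 mulr1 //.
Qed.

(** * Linear spans over the base field and monomials in the generators *)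

Definition Ksubspace (V : set R) :=
  V 0 /\ forall c u v, V u -> V v -> V (kR c * u + v).

Definition Kspan (l : seq R) : set R :=
  [set z | forall V, Ksubspace V -> (forall a, a \in l -> V a) -> V z].

Lemma Kspan_subspace l : Ksubspace (Kspan l).
Proof.
split=> [V [] //|c u v hu hv V hV lV]; apply: hV.2; [exact: hu|exact: hv].
Qed.

Lemma Kspan_mem l a : a \in l -> Kspan l a.
Proof. by move=> al V _; apply. Qed.

Lemma Kspan_sub l (V : set R) : Ksubspace V -> (forall a, a \in l -> V a) ->
  Kspan l `<=` V.
Proof. by move=> hV lV z; apply. Qed.

Lemma Kspan_lin l m (f : R -> R) : f 0 = 0 ->
  (forall c u v, f (kR c * u + v) = kR c * f u + f v) ->
  (forall a, a \in l -> Kspan m (f a)) -> forall z, Kspan l z -> Kspan m (f z).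
Proof.
move=> f0 fl lm z; apply: (Kspan_sub (V := fun z => Kspan m (f z))) => //.
have [k0 kl] := Kspan_subspace m.
by split=> [|c u v hu hv]; rewrite ?f0 // fl; apply: kl.
Qed.

Lemma Kspan_coord l z : Kspan l z ->
  exists c : 'I_(size l) -> K, z = \sum_i kR (c i) * l`_i.
Proof.
apply: (Kspan_sub (V := fun z => exists c : 'I_(size l) -> K,
  z = \sum_i kR (c i) * l`_i)).
  split=> [|a u v [c ->] [d ->]].
    by exists (fun=> 0); rewrite big1 // => i _; rewrite rmorph0 mul0r.
  exists (fun i => a * c i + d i); rewrite mulr_sumr -big_split /=.
  by apply: eq_bigr => i _; rewrite rmorphD rmorphM /=; ring.
move=> a al; have il : (index a l < size l)%N by rewrite index_mem.
exists (fun i => (i == Ordinal il)%:R).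
rewrite (bigD1 (Ordinal il)) //= eqxx rmorph1 mul1r nth_index // big1 ?addr0 //.
by move=> i /negPf->; rewrite rmorph0 mul0r.
Qed.

(** The coordinate matrix has more rows than columns, so its left kernel contains a nonzero row. *)
Lemma Kspan_dependent (I : finType) (l : seq R) (v : I -> R) :
  (forall i, Kspan l (v i)) -> (size l < #|I|)%N ->
  exists2 c : I -> K, exists i, c i != 0 & \sum_i kR (c i) * v i = 0.
Proof.
move=> lv sI; have [a aP] := choice (fun i => Kspan_coord (lv i)).
pose M := \matrix_(i < #|I|, k < size l) a (enum_val i) k.
have /rowV0Pn[u uM u0] : kermx M != 0.
  rewrite kermx_eq0 /row_free; apply: contraTneq sI => <-.
  by rewrite -leqNgt rank_leq_col.
exists (fun i => u 0 (enum_rank i)).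
  have /rV0Pn[k uk] := u0.
  by exists (enum_val k); rewrite enum_valK.
under eq_bigr do rewrite aP mulr_sumr.
rewrite exchange_big big1 // => k _ /=.
under eq_bigr do rewrite mulrA -rmorphM.
rewrite -mulr_suml -rmorph_sum /=.
move/sub_kermxP: uM => /matrixP/(_ 0 k); rewrite !mxE => uM.
rewrite (reindex _ (onW_bij _ (enum_val_bij I))) /=.
under eq_bigr do rewrite enum_valK.
suff -> : \sum_(i < #|I|) u 0 i * a (enum_val i) k = 0 by rewrite rmorph0 mul0r.
by rewrite -[RHS]uM; apply: eq_bigr => i _; rewrite mxE.
Qed.

Fixpoint words (s : seq R) n :=
  if n is n'.+1 then [seq y * w | y <- s, w <- words s n'] else [:: 1].

Lemma words_catl s a b u v : u \in words s a -> v \in words s b ->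
  u * v \in words s (a + b).
Proof.
move=> + hv; elim: a u => [|a IH] u /=; first by rewrite inE => /eqP->; rewrite mul1r.
case/allpairsP => -[y w] /= [ys wa ->]; rewrite -mulrA.
by apply/allpairsP; exists (y, w * v); split=> //; apply: IH.
Qed.

Lemma words_cons y s n w : w \in words (y :: s) n ->
  exists e w', [/\ (e <= n)%N, w' \in words s (n - e) & w = y ^+ e * w'].
Proof.
elim: n w => [|n IH] w.
  by move=> hw; exists 0%N, w; split=> //; rewrite expr0 mul1r.
case/allpairsP => -[z w1] /= [+ /IH[e [w' [en hw' ->]]] ->].
rewrite inE => /predU1P[->|zs].
  by exists e.+1, w'; rewrite subSS exprS mulrA.
exists e, (z * w'); split; [exact: leqW| |by rewrite mulrCA].
by rewrite subSn //; apply/allpairsP; exists (z, w').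
Qed.

(** Pigeonhole, one letter at a time: in a word of length at least k + N, either [y] occurs k times
    or at least N of the letters come from the remaining alphabet. *)
Lemma words_dvd x s : (forall y, y \in s -> exists k r, y ^+ k = r * x) ->
  exists N, forall n w, (N <= n)%N -> w \in words s n -> exists r, w = r * x.
Proof.
elim: s => [|y s IH] sx.
  (* Over the empty alphabet there are no words of positive length; the empty word 1 has to be
     excluded. *)
  by exists 1%N => -[].
have [|N NP] := IH; first by move=> z zs; apply: sx; rewrite inE zs orbT.
have [k [r yk]] := sx y (mem_head _ _).
exists (k + N)%N => n w nN /words_cons[e [w' [en hw' ->]]].
have [ke|ek] := leqP k e.
  exists (y ^+ (e - k) * r * w').
  by rewrite -[in LHS](subnK ke) exprD yk; ring.
have [|r' ->] := NP _ _ _ hw'; first by lia.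
by exists (y ^+ e * r'); rewrite mulrA.
Qed.

Variable s : seq R.
Hypothesis sG1 : forall x, x \in s -> G 1%N x.
Hypothesis sgen : generates_ring (range kR `|` [set x | x \in s]).

Lemma words_graded n w : w \in words s n -> G n w.
Proof.
elim: n w => [|n IH] w /=.
  by rewrite inE => /eqP->; rewrite -(rmorph1 kR).
by case/allpairsP => -[y w'] /= [/sG1 Gy /IH Gw ->]; apply: (GM Gy Gw).
Qed.

Lemma graded_Ksubspace n : Ksubspace (G n).
Proof. by split=> // c u v Gu Gv; apply: GD => //; apply: (GM (Giota c) Gu). Qed.

(** The elements having a decomposition whose components are spanned by words of the right length
    form a subring containing the generators, hence everything; decompositions being unique, this
    applies to the given component. *)
Lemma graded_words n : G n = Kspan (words s n).
Proof.
apply/seteqP; split; last first.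
  by apply: Kspan_sub (graded_Ksubspace n) _; apply: words_graded.
pose W (P : {poly R}) := forall i, Kspan (words s i) P`_i.
have WG P : W P -> homog P.
  move=> hP i; have := hP i.
  by apply: Kspan_sub; [exact: graded_Ksubspace|exact: words_graded].
suff TT : [set z | exists2 P, W P & P.[1] = z] = setT.
  move=> z Gz'; have [P WP Pz] : [set z | exists2 P, W P & P.[1] = z] z by rewrite TT.
  have PE : z *: 'X^n = P.
    apply: homog_eval_inj; [exact: homog_monom|exact: WG|].
    by rewrite hornerZ hornerXn expr1n mulr1.
  by have := WP n; rewrite -PE coefZ coefXn eqxx mulr1.
have monomT n' a : Kspan (words s n') a -> exists2 P, W P & P.[1] = a.
  move=> ha; exists (a *: 'X^n'); last by rewrite hornerZ hornerXn expr1n mulr1.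
  move=> i; rewrite coefZ coefXn; case: eqP => [->|_]; rewrite ?mulr1 ?mulr0 //.
  by have [] := Kspan_subspace (words s i).
have kRS c : Kspan (words s 0) (kR c).
  have [k0 kl] := Kspan_subspace (words s 0).
  have := kl c 1 0 _ k0; rewrite mulr1 addr0; apply.
  by apply: Kspan_mem; rewrite inE.
apply: sgen; last first.
  move=> z [[c _ <-]|zs] /=; first exact: (monomT 0%N).
  apply: (monomT 1%N); apply: Kspan_mem; apply/allpairsP.
  by exists (z, 1); rewrite mulr1; split=> //; rewrite inE.
split; first by apply: mem_set; apply: (monomT 0%N); rewrite -(rmorph1 kR).
  move=> u v /set_mem[P WP <-] /set_mem[Q WQ <-]; apply: mem_set.
  exists (P - Q); last by rewrite hornerD hornerN.
  move=> i; rewrite coefB addrC -mulN1r -(rmorphN1 kR).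
  by have [_ kl] := Kspan_subspace (words s i); apply: kl.
move=> u v /set_mem[P WP <-] /set_mem[Q WQ <-]; apply: mem_set.
exists (P * Q); last by rewrite hornerM.
move=> i; rewrite coefM; have [k0 kl] := Kspan_subspace (words s i).
apply: big_ind => // [a b ha hb|j _].
  by rewrite -[a]mul1r -(rmorph1 kR); apply: kl.
apply: (Kspan_lin (l := words s j) (f := fun a => a * Q`_(i - j))) (WP j).
- by rewrite mul0r.
- by move=> c a b; rewrite mulrDl mulrA.
move=> a aj.
apply: (Kspan_lin (l := words s (i - j)) (f := fun b => a * b)) (WQ (i - j)%N).
- by rewrite mulr0.
- by move=> c b b'; rewrite mulrDr mulrCA.
move=> b bj; apply: Kspan_mem; have := words_catl aj bj.
by rewrite subnKC // -ltnS.
Qed.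

(** * Linear growth and algebraic dependence for rings finite over K[x] *)

Section FiniteOverLine.
Variables (x : R) (N : nat).
Hypothesis Gx : G 1%N x.
Hypothesis xN : forall n w, (N <= n)%N -> w \in words s n -> exists r, w = r * x.

Definition line_basis := flatten [seq words s i | i <- iota 0 N.+1].

Definition line_span d := [seq x ^+ k * b | k <- iota 0 d.+1, b <- line_basis].

Lemma size_line_span d : size (line_span d) = (d.+1 * size line_basis)%N.
Proof. by rewrite size_allpairs size_iota. Qed.

(** Up to degree [N] the words themselves are in the basis; above it a form is [x] times a form of
    one degree less. As [line_span e] has length linear in [e], this bounds the Hilbert growth. *)
Lemma graded_line_span d e z : (d <= e)%N -> G d z -> Kspan (line_span e) z.
Proof.
elim: d e z => [|d IH] e z de Gz'.
  move: (Gz'); rewrite graded_words; apply: (Kspan_sub (Kspan_subspace _)) => w hw.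
  apply: Kspan_mem; apply/allpairsP; exists (0%N, w); split=> /=.
  - by rewrite inE.
  - by apply/flatten_mapP; exists 0%N; rewrite ?mem_iota.
  - by rewrite mul1r.
have [dN|Nd] := leqP d.+1 N.
  move: (Gz'); rewrite graded_words; apply: (Kspan_sub (Kspan_subspace _)) => w hw.
  apply: Kspan_mem; apply/allpairsP; exists (0%N, w); split=> //=.
  - by apply/flatten_mapP; exists d.+1; rewrite ?mem_iota.
  - by rewrite mul1r.
have [r zr] : exists r, z = r * x.
  move: (Gz'); rewrite graded_words.
  apply: (Kspan_sub (V := fun z => exists r, z = r * x)) => [|w hw].
    split=> [|c _ _ [u ->] [v ->]]; first by exists 0; rewrite mul0r.
    by exists (kR c * u + v); ring.
  by apply: xN hw; apply: ltnW.
have [r' Gr ->] := homog_dvd Gx Gz' zr.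
apply: (Kspan_lin (l := line_span d) (f := fun a => a * x)) (IH d _ (leqnn d) Gr).
- by rewrite mul0r.
- by move=> c u v; ring.
move=> _ /allpairsP[[k b] [hk hb ->]].
apply: Kspan_mem; apply/allpairsP; exists (k.+1, b); split=> //.
  by move: hk; rewrite !mem_iota /=; lia.
by rewrite exprS /=; ring.
Qed.

Lemma poly_line_span P d : homog P -> (size P <= d.+1)%N ->
  Kspan (line_span d) P.[1].
Proof.
move=> hP sP; rewrite horner_coef; have [k0 kl] := Kspan_subspace (line_span d).
apply: big_ind => // [u v hu hv|i _].
  by rewrite -[u]mul1r -(rmorph1 kR); apply: kl.
rewrite expr1n mulr1; apply: (graded_line_span (d := i)) => //.
by rewrite -ltnS (leq_trans _ sP).
Qed.

Definition eval_at (g : R) : {poly K} -> R :=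
  horner_morph (fun c => mulrC g (kR c) : GRing.comm g (kR c)).

HB.instance Definition _ g := GRing.RMorphism.on (eval_at g).

Lemma algebraic_dependence f g :
  exists2 W : {poly {poly K}}, W != 0 & (map_poly (eval_at g) W).[f] = 0.
Proof.
have [P hP <-] := homog_exists f; have [Q hQ <-] := homog_exists g.
pose e := maxn (size P) (size Q); pose B := size line_basis.
(* The M^2 products of powers of [f] and [g] with exponents below [M] lie in a span of (2eM + 1)B
   elements, and this [M] makes M^2 larger. *)
pose M := (2 * e * B + B).+1.
have PQ (i : 'I_M * 'I_M) :
    Kspan (line_span (2 * e * M)) (P.[1] ^+ i.1 * Q.[1] ^+ i.2).
  rewrite -!horner_exp -hornerM; apply: poly_line_span.
    by apply: homogM; apply: homogXn.
  have leM (S : {poly R}) (k : 'I_M) : (size S <= e)%N ->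
      (size (S ^+ k) <= (e * M).+1)%N.
    move=> Se; apply: leq_trans (size_poly_exp_leq S k) _; rewrite ltnS.
    by apply: leq_mul (ltnW (ltn_ord k)); apply: leq_trans (leq_pred _) Se.
  apply: leq_trans (size_polyMleq _ _) _.
  have := leM P i.1 (leq_maxl _ _); have := leM Q i.2 (leq_maxr _ _).
  rewrite -mulnA; move: (e * M)%N (size _) (size _) => *; lia.
have [|c [[a0 b0] /= c0] cs] := Kspan_dependent PQ.
  rewrite size_line_span card_prod card_ord -/B /M; nia.
pose W := \poly_(a < M) \poly_(b < M) c (inord a, inord b).
exists W.
  apply: contraNneq c0 => /(congr1 (fun V : {poly {poly K}} => V`_a0`_b0)).
  by rewrite coef_poly ltn_ord coef_poly ltn_ord !inord_val !coef0 => ->.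
rewrite (horner_coef_wide (n := M)); last first.
  by rewrite (leq_trans (size_poly _ _)) // size_poly.
transitivity (\sum_(a < M) \sum_(b < M)
    kR (c (a, b)) * (P.[1] ^+ a * Q.[1] ^+ b)); last first.
  by rewrite pair_bigA -[RHS]cs; apply: eq_bigr => -[].
apply: eq_bigr => a _; rewrite coef_map coef_poly ltn_ord /= /eval_at /horner_morph.
rewrite (horner_coef_wide (n := M)); last first.
  by rewrite (leq_trans (size_poly _ _)) // size_poly.
rewrite mulr_suml; apply: eq_bigr => b _.
by rewrite coef_map coef_poly ltn_ord /= !inord_val; ring.
Qed.

Lemma poly_nonroot0 (S : idomainType) (q : {poly S}) : q != 0 ->
  exists k (q' : {poly S}), q'`_0 != 0 /\ q = q' * 'X^k.
Proof.
move=> q0; have [k [q' /implyP/(_ q0) h qE]] := multiplicity_XsubC q 0.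
by exists k, q'; rewrite -horner_coef0; split; rewrite // {1}qE subr0.
Qed.

(** Cancel powers of [f] in a relation W(f, g) = 0: its constant term, a nonzero polynomial in [g],
    then lies in (f) and so in [P1]. It equals w(g) g^l with w(0) nonzero. If [g] were not in [P1],
    then w(g) would be in [P2], and so would the unit w(0), as [g] is in [P2]. *)
Lemma finite_over_line_chain (P1 P2 : set R) f g :
  prime_ideal P1 -> prime_ideal P2 -> P1 `<=` P2 ->
  f != 0 -> P1 f -> P2 g -> P1 g.
Proof.
move=> pP1 pP2 P12 f0 P1f P2g; apply: contrapT => P1g.
have [W W0 Wf] := algebraic_dependence f g.
have [k [W' [W'0 WE]]] := poly_nonroot0 W0.
have [l [w [w0 wE]]] := poly_nonroot0 W'0.
(* Used twice: modulo [f] for the relation, and modulo [g] for its constant term. *)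
have const (q : {poly R}) a : exists r, q.[a] = q`_0 + r * a.
  elim/poly_ind: q => [|q c _]; first by exists 0; rewrite horner0 coef0; ring.
  exists q.[a]; rewrite hornerMXaddC coefD coefMX coefC /=; ring.
have {Wf} : (map_poly (eval_at g) W').[f] = 0.
  move: Wf; rewrite WE rmorphM /= map_polyXn hornerM hornerXn => /eqP.
  by rewrite mulf_eq0 expf_eq0 (negPf f0) andbF orbF => /eqP.
have [r ->] := const (map_poly (eval_at g) W') f.
rewrite coef_map wE /= rmorphM => wf.
have P1w : P1 (eval_at g w * eval_at g 'X^l).
  have -> : eval_at g w * eval_at g 'X^l = 0 - r * f.
    by apply/eqP; rewrite sub0r -addr_eq0 wf.
  apply: prime_idealB => //; last exact: prime_idealM.
  by rewrite -(mul0r f); apply: prime_idealM.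
case/(prime_ideal_mul pP1): P1w => [/P12|]; last first.
  by rewrite rmorphXn /= /eval_at horner_morphX => /(prime_idealX pP1).
rewrite /eval_at /horner_morph; have [r' ->] := const (map_poly kR w) g.
rewrite coef_map /= => P2w; apply: (prime_ideal1 pP2).
have -> : 1 = kR (w`_0)^-1 * (kR w`_0 + r' * g - r' * g).
  by rewrite addrK -rmorphM mulVf // rmorph1.
by apply: prime_idealM => //; apply: prime_idealB => //; apply: prime_idealM.
Qed.

End FiniteOverLine.
Lemma standard_graded_colon_witness n : krull_dim R n -> (2 <= n)%N ->
  exists x y : R, [/\ x != 0, irrelevant_ideal G y
    & forall a k r, a * y ^+ k = r * x -> irrelevant_ideal G a].
Proof.
move=> [[P hP] _] n2; have [pP sP] := hP.
have [f [g [f0 P1f P2g P1g]]] := prime_chain_witness hP n2.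
have [[x [y [xs ys x0 yx]]]|noxy] := pselect (exists x y,
    [/\ x \in s, y \in s, x != 0 & forall k r, y ^+ k <> r * x]).
  exists x, y; split=> //; last first.
    by apply: irrelevant_ideal_colon yx; apply: sG1.
  have yX : homog (y *: 'X^1) by apply: homog_monom; apply: sG1.
  have := homog_irrelevant yX; rewrite hornerZ hornerXn expr1n mulr1; apply.
  by rewrite coefZ coefXn mulr0.
have [x Gx xP] : exists2 x, G 1%N x &
    forall y, y \in s -> exists k r, y ^+ k = r * x.
  have [/hasP[x xs x0]|/hasPn s0] := boolP (has (fun x => x != 0) s).
    exists x => [|y ys]; first exact: sG1.
    apply: contrapT => yx; apply: noxy; exists x, y; split=> // k r e.
    by apply: yx; exists k, r.
  (* If all generators vanish, x = 0 divides each of them. *)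
  exists 0 => // y /s0; rewrite negbK => /eqP->.
  by exists 1%N, 0; rewrite mul0r.
have [N NP] := words_dvd xP; case: P1g.
apply: (finite_over_line_chain Gx NP (pP 1%N (ltnW n2)) (pP 2%N n2) _ f0) => //.
by have [] := sP 1%N n2.
Qed.

End StandardGraded.

(** * Elements of the injective hull not killed by powers of m *)

Lemma ideal_powX (R : comNzRingType) (m : set R) y t :
  m y -> ideal_pow m t (y ^+ t).
Proof.
move=> my I _; apply; exists (fun=> y) => //.
by rewrite prodr_const card_ord.
Qed.

Theorem theorem5p10
  (R : idomainType) (m : set R) (p n : nat)
  (HR : complete_local_domain m \/ standard_graded_domain m)
  (Hp : p \in [pchar R])
  (Hdim : krull_dim R n) (Hn : (2 <= n)%N)
  (Rinf : comNzRingType) (i : {rmorphism R -> Rinf})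
  (Hi : is_perfect_closure p i)
  (minf : set Rinf) (Hminf : maximal_ideal minf) (Hover : i @^-1` minf = m)
  (Kinf : fieldType) (pi : {rmorphism Rinf -> Kinf})
  (Hpi : is_residue_field minf pi)
  (E : lmodType Rinf) (j : {linear residue_module pi -> E})
  (Hj : is_injective_hull j) :
  exists v : E, forall t : nat, (0 < t)%N ->
    ~ (forall r : R, ideal_pow m t r -> i r *: v = 0).
Proof.
have [x [y [x0 my xy]]] : exists x y : R, [/\ x != 0, m y
    & forall s k r, s * y ^+ k = r * x -> m s].
  case: HR => [[_ loc _]|[K [kR [G [[gradG G0 [s [sG sgen]]] ->]]]]].
    exact: local_ring_colon_witness loc Hdim Hn.
  exact: (standard_graded_colon_witness gradG G0 sG sgen Hdim Hn).
have mP r : m r -> pi (i r) = 0.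
  by rewrite -Hover => mr; apply/(Hpi.2 (i r)).
have [|J [u [hJ uJ uyJ]]] :=
    @perfect_closure_nonseparated_ideal R p Hp _ i Hi _ pi x y x0.
  by move=> s k r /xy /mP.
have [injE injj _] := Hj.
have [v vP] := injective_module_not_torsion injE injj hJ uJ uyJ.
(* If m^t killed [v], so would [y ^+ t], which belongs to it. *)
exists v => t _ mv; apply: (vP t); rewrite -rmorphXn; apply: mv.
exact: ideal_powX.
Qed.
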